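(* The set of rigid Maurer-Cartan elements in $\mathcal{MC}_2$ coincides with the one-parameter family $\{\omega_t\}_{t\in\mathbb{R}}$ given by $$\omega_t=e\boxtimes e+\sum_{k\ge1}(B+tA)^{\diamond k},$$ where $B=b\boxtimes a+c\boxtimes b$ and $A=b\boxtimes c+a\boxtimes b-b\boxtimes a-c\boxtimes b$. Among these, $\omega_{1/2}$ is the only symmetric one, and $\omega_0$ and $\omega_1$ are the only associative ones.
   Context: Over $\mathbb{R}$, let $\Omega=\bigoplus_{k\ge1,l}\Omega^k(l)$ be the bigraded vector space where $\Omega^{k}$ has as basis the words of length $k-1$ in the letters $a,b,c$; the empty word $e$ spans $\Omega^1$; a word in which $b$ occurs $r$ times has $l=-r$. Let $\diamond$ be concatenation (unit $e$). Structure maps: $w\circ w'=w\diamond c\diamond w'$; $d_i(e_1\cdots e_{k-1})=e_1\cdots e_{i-1}\,a\,e_i\cdots e_{k-1}$ for $1\le i\le k$ on $\Omega^k$; $\partial$ is the linear map with $\partial e=\partial a=\partial c=0$, $\partial b=c-a$, $\partial(w\diamond w')=\partial(w)\diamond w'+(-1)^{l(w)}w\diamond\partial(w')$. Put $L_1=e$, $L_n=b^{\diamond(n-1)}$ for $n\ge2$. $\Omega_2=\Omega\boxtimes\Omega$, where $(\mathcal{A}\boxtimes\mathcal{B})^k(l)=\bigoplus_{i+j=l}\mathcal{A}^k(i)\otimes\mathcal{B}^k(j)$ with $\partial(a\boxtimes b)=\partial a\boxtimes b+(-1)^{l(a)}a\boxtimes\partial b$, $d_i(a\boxtimes b)=d_ia\boxtimes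 d_ib$, $(a\boxtimes b)\circ(a'\boxtimes b')=(-1)^{l(b)l(a')}(a\circ a')\boxtimes(b\circ b')$, and $\diamond$ is extended by $(a_1\boxtimes a_2)\diamond(b_1\boxtimes b_2)=(-1)^{l(a_2)l(b_1)}(a_1\diamond b_1)\boxtimes(a_2\diamond b_2)$, with unit $e\boxtimes e$. $\bar\Omega_2$ is the DGA with $\bar\Omega_2^n=\prod_{k+l=n}\Omega_2^k(l)$, product $a\star b=(-1)^{k(a)|b|}a\circ b$ ($|b|=k(b)+l(b)$), differential $d_{\mathrm{tot}}=\partial+(-1)^n\sum_{i=1}^k(-1)^id_i$ on elements of total degree $n$ in $\Omega_2^k$. $\mathcal{MC}_2$ is the set of $\omega=\omega_1+\omega_2+\cdots\in\bar\Omega_2^1$ ($\omega_k\in\Omega_2^k(1-k)$) with $d_{\mathrm{tot}}\omega+\omega\star\omega=0$, $\omega_1=e\boxtimes e$. Each $\omega\in\mathcal{MC}_2$ determines a unique linear map $\Delta_\omega:\Omega\to\Omega_2$ preserving both degrees and commuting with $\circ,\partial,d_i$, with $\Delta_\omega(L_n)=\omega_n$. $\omega$ is rigid if $\Delta_\omega$ is a morphism of unital algebras with respect to $\diamond$; associative if $(\Delta_\omega\boxtimes\mathrm{id})\circ\Delta_\omega=(\mathrm{id}\boxtimes\Delta_\omega)\circ\Delta_\omega$; symmetric if it is fixed by the flip $a_1\boxtimes a_2\mapsto(-1)^{l(a_1)l(a_2)}a_2\boxtimes a_1$. *)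

(* Defs.v *)
From HB Require Import structures.
From mathcomp Require Import all_boot all_order all_algebra finmap.
From mathcomp Require Import monalg.
From mathcomp Require Import boolp classical_sets reals.

Set Implicit Arguments.
Unset Strict Implicit.
Unset Printing Implicit Defensive.

Import GRing.Theory.

Local Open Scope ring_scope.

Inductive letter : Type := La | Lb | Lc.

Definition letter_code (x : letter) : option bool :=
  match x with La => None | Lb => Some true | Lc => Some false end.

Definition letter_decode (o : option bool) : letter :=
  match o with None => La | Some true => Lb | Some false => Lc end.

Lemma letter_codeK : cancel letter_code letter_decode.
Proof. by case. Qed.

HB.instance Definition _ := Choice.copy letter (can_type letter_codeK).

(* {malg R[seq X]} is used only as the free R-module on the words over X.
   A basis element u [x] v of the Hadamard product (u, v words of the same
   length) is encoded as the word [zip u v] of pairs of letters, so that the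
   power Omega^{[x] 2} is the free module on the words over letter * letter. *)
Notation Omega R := {malg R[seq letter]}.
Notation Omega2 R := {malg R[seq (letter * letter)]}.

(* An element of the product over k of the Omega2^k, given by its components;
   the component of index 0 of a homogeneous element is 0, see [Obar_deg]. *)
Notation Obar2 R := (nat -> Omega2 R).

Definition kdeg (X : Type) (w : seq X) : nat := (size w).+1.

Definition ldeg (w : seq letter) : int := - (count_mem Lb w)%:Z.

Definition ldeg2 (w : seq (letter * letter)) : int :=
  ldeg (unzip1 w) + ldeg (unzip2 w).

Definition insert_a (i : nat) (w : seq letter) : seq letter :=
  take i.-1 w ++ La :: drop i.-1 w.

Section Structure.
Context {R : realType}.

Definition lext (X : choiceType) (V : lmodType R) (f : X -> V)
    (x : {malg R[X]}) : V :=
  \sum_(u <- msupp x) x@_u *: f u.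

Definition bext (X Y : choiceType) (V : lmodType R) (f : X -> Y -> V)
    (x : {malg R[X]}) (y : {malg R[Y]}) : V :=
  \sum_(u <- msupp x) \sum_(v <- msupp y) (x@_u * y@_v) *: f u v.

(* Membership in the summands Omega^k and Omega^k(l), resp. Omega2^k(l);
   [deg] gives the degree l of a word. *)
Definition of_arity (X : choiceType) (k : nat) (x : {malg R[seq X]}) : Prop :=
  forall w, w \in msupp x -> kdeg w = k.

Definition of_bidegree (X : choiceType) (deg : seq X -> int) (k : nat)
    (l : int) (x : {malg R[seq X]}) : Prop :=
  forall w, w \in msupp x -> kdeg w = k /\ deg w = l.

Definition dia : Omega R -> Omega R -> Omega R :=
  bext (fun u v => << u ++ v >>).

Definition unitO : Omega R := << [::] >>.
Definition a_ : Omega R := << [:: La] >>.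
Definition b_ : Omega R := << [:: Lb] >>.
Definition c_ : Omega R := << [:: Lc] >>.

Definition circ (x y : Omega R) : Omega R := dia (dia x c_) y.

Definition face (i : nat) : Omega R -> Omega R :=
  lext (fun w => << insert_a i w >>).

Definition partial_letter (x : letter) : Omega R :=
  if x is Lb then c_ - a_ else 0.

Fixpoint partial_word (w : seq letter) : Omega R :=
  if w is x :: w' then
    dia (partial_letter x) << w' >>
    + (-1) ^ ldeg [:: x] *: dia << [:: x] >> (partial_word w')
  else 0.

Definition partial : Omega R -> Omega R := lext partial_word.

Definition L (n : nat) : Omega R := << nseq n.-1 Lb >>.

(* The tensor x [x] y; it vanishes on components of different arities. *)
Definition box (X Y : choiceType) :
    {malg R[seq X]} -> {malg R[seq Y]} -> {malg R[seq (X * Y)]} :=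
  bext (fun u v => if size u == size v then << zip u v >> else 0).

(* Structure maps of Omega2; the word w stands for unzip1 w [x] unzip2 w. *)
Definition unit2 : Omega2 R := box unitO unitO.

Definition dia2 : Omega2 R -> Omega2 R -> Omega2 R :=
  bext (fun w w' => (-1) ^ (ldeg (unzip2 w) * ldeg (unzip1 w')) *:
    box (dia << unzip1 w >> << unzip1 w' >>)
        (dia << unzip2 w >> << unzip2 w' >>)).

Definition circ2 : Omega2 R -> Omega2 R -> Omega2 R :=
  bext (fun w w' => (-1) ^ (ldeg (unzip2 w) * ldeg (unzip1 w')) *:
    box (circ << unzip1 w >> << unzip1 w' >>)
        (circ << unzip2 w >> << unzip2 w' >>)).

Definition face2 (i : nat) : Omega2 R -> Omega2 R :=
  lext (fun w => box (face i << unzip1 w >>) (face i << unzip2 w >>)).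

Definition partial2 : Omega2 R -> Omega2 R :=
  lext (fun w => box (partial << unzip1 w >>) << unzip2 w >>
    + (-1) ^ ldeg (unzip1 w) *: box << unzip1 w >> (partial << unzip2 w >>)).

Definition flip : Omega2 R -> Omega2 R :=
  lext (fun w => (-1) ^ (ldeg (unzip1 w) * ldeg (unzip2 w)) *:
    box << unzip2 w >> << unzip1 w >>).

(* f [x] g for maps f and g of bidegree 0, whence no sign. *)
Definition boxmap (X Y X' Y' : choiceType)
    (f : {malg R[seq X]} -> {malg R[seq X']})
    (g : {malg R[seq Y]} -> {malg R[seq Y']}) :
    {malg R[seq (X * Y)]} -> {malg R[seq (X' * Y')]} :=
  lext (fun w => box (f << unzip1 w >>) (g << unzip2 w >>)).

Definition box_assoc (X Y Z : choiceType) :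
    {malg R[seq (X * (Y * Z))]} -> {malg R[seq ((X * Y) * Z)]} :=
  lext (fun w => << [seq ((p.1, p.2.1), p.2.2) | p <- w] >>).

Definition Obar_deg (n : int) (x : Obar2 R) : Prop :=
  forall k : nat, of_bidegree ldeg2 k (n - k%:Z) (x k).

Definition tdeg (w : seq (letter * letter)) : int := (kdeg w)%:Z + ldeg2 w.

Definition star (x y : Obar2 R) : Obar2 R := fun k =>
  \sum_(i < k.+1)
    bext (fun w w' => (-1) ^ ((kdeg w)%:Z * tdeg w') *: circ2 << w >> << w' >>)
      (x i) (y (k - i)%N).

(* The differential on elements of total degree n; the faces of the component
   of arity k - 1 contribute to the component of arity k. *)
Definition dtot (n : int) (x : Obar2 R) : Obar2 R := fun k =>
  partial2 (x k)
  + (-1) ^ n *: \sum_(1 <= i < k) (-1) ^+ i *: face2 i (x k.-1).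

Definition MC2 (w : Obar2 R) : Prop :=
  [/\ Obar_deg 1 w, forall k, dtot 1 w k + star w w k = 0 & w 1%N = unit2].

Record is_Delta (w : Obar2 R) (D : {linear Omega R -> Omega2 R}) : Prop := {
  Delta_deg : forall k l x,
    of_bidegree ldeg k l x -> of_bidegree ldeg2 k l (D x);
  Delta_circ : forall x y, D (circ x y) = circ2 (D x) (D y);
  Delta_partial : forall x, D (partial x) = partial2 (D x);
  Delta_face : forall k i x, of_arity k x -> (1 <= i <= k)%N ->
    D (face i x) = face2 i (D x);
  Delta_L : forall n, (1 <= n)%N -> D (L n) = w n
}.

(* By [is_Delta_unique] below, [exists D, is_Delta w D /\ P D] is the
   statement that the map determined by w satisfies P. *)
Definition rigid (w : Obar2 R) : Prop :=
  exists D : {linear Omega R -> Omega2 R},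
    [/\ is_Delta w D, D unitO = unit2
      & forall x y, D (dia x y) = dia2 (D x) (D y)].

Definition associative_MC (w : Obar2 R) : Prop :=
  exists D : {linear Omega R -> Omega2 R}, is_Delta w D /\
    forall x, boxmap D id (D x) = box_assoc (boxmap id D (D x)).

Definition symmetric_MC (w : Obar2 R) : Prop := forall k, flip (w k) = w k.

Definition elB : Omega2 R := box b_ a_ + box c_ b_.

Definition elA : Omega2 R :=
  box b_ c_ + box a_ b_ - box b_ a_ - box c_ b_.

(* The n-th power of an element of Omega2^2 lies in Omega2^(n+1). *)
Definition pow2 (x : Omega2 R) (n : nat) : Omega2 R := iter n (dia2 x) unit2.

Definition omega_ (t : R) : Obar2 R := fun k =>
  if k is n.+1 then pow2 (elB + t *: elA) n else 0.

Lemma lextU (X : choiceType) (V : lmodType R) (f : X -> V) (u : X) :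
  lext f << u >> = f u.
Proof. by rewrite /lext msuppU oner_eq0 big_seq_fset1 mcoeffUU scale1r. Qed.

Lemma bextU (X Y : choiceType) (V : lmodType R) (f : X -> Y -> V) u v :
  bext f << u >> << v >> = f u v.
Proof.
by rewrite /bext !msuppU oner_eq0 !big_seq_fset1 !mcoeffUU mulr1 scale1r.
Qed.

Lemma is_Delta_unique (w : Obar2 R) (D D' : {linear Omega R -> Omega2 R}) :
  is_Delta w D -> is_Delta w D' -> D =1 D'.
Proof.
move=> HD HD'; have basis u : D << u >> = D' << u >>.
  elim/ltn_ind: {u}(size u) {-2}u (erefl (size u)) => m IH u Em.
  have {}IH v : (size v < m)%N -> D << v >> = D' << v >> by move=> /IH; apply.
  have [uc|uc] := boolP (Lc \in u).
    case/splitPr: uc Em => u1 u2; rewrite size_cat /= => Em.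
    have -> : << u1 ++ Lc :: u2 >> = circ << u1 >> << u2 >> :> Omega R.
      by rewrite /circ /dia !bextU -catA.
    rewrite (Delta_circ HD) (Delta_circ HD').
    by rewrite !IH // -Em addnS ltnS ?leq_addl ?leq_addr.
  have [ua|ua] := boolP (La \in u).
    case/splitPr: ua Em {uc} => u1 u2; rewrite size_cat /= => Em.
    have -> : << u1 ++ La :: u2 >> = face (size u1).+1 << u1 ++ u2 >> :> Omega R.
      by rewrite /face lextU /insert_a /= take_size_cat // drop_size_cat.
    have Ha : @of_arity _ (size (u1 ++ u2)).+1 (<< u1 ++ u2 >> : Omega R).
      by move=> v; rewrite msuppU oner_eq0 in_fset1 => /eqP ->.
    have Hi : (1 <= (size u1).+1 <= (size (u1 ++ u2)).+1)%N.
      by rewrite size_cat /= ltnS leq_addr.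
    rewrite (Delta_face HD Ha Hi) (Delta_face HD' Ha Hi) IH //.
    by rewrite -Em size_cat addnS.
  have -> : << u >> = L (size u).+1.
    rewrite /L /=; congr (<< _ >>); apply/all_pred1P/allP => -[] // Hx.
      by rewrite Hx in ua.
    by rewrite Hx in uc.
  by rewrite (Delta_L HD) // (Delta_L HD').
move=> x; rewrite [x]monalgE !raddf_sum; apply: eq_bigr => u _.
have -> : << x@_u *g u >> = x@_u *: << u >> :> Omega R.
  by apply/malgP => v; rewrite mcoeffZ !mcoeffU; case: eqP => _; rewrite ?mulr1 ?mulr0.
by rewrite /= !linearZ_LR basis.
Qed.

End Structure.

(* Main.v *)
From HB Require Import structures.
Require Import Defs.
From mathcomp Require Import all_boot all_order all_algebra finmap.
From mathcomp Require Import monalg.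
From mathcomp Require Import zify lra.
From mathcomp Require Import boolp classical_sets reals.

Set Implicit Arguments.
Unset Strict Implicit.
Unset Printing Implicit Defensive.

Import GRing.Theory Num.Theory.

Local Open Scope classical_set_scope.
Local Open Scope ring_scope.

(** Write x_t = B + t A, an element of arity 2 and degree -1 in Omega2.

    Under concatenation Omega is the free algebra on a, b, c, and every
    structure map is visible on letters: inserting a face is multiplication by
    a in the middle of a word, x o y is x times c times y, and the differential
    is the derivation with b |-> c - a.  The same holds in Omega2 for the
    Koszul signed product [dia2], with a (x) a and c (x) c in the places of a
    and c.  Hence a multiplicative, bidegree preserving map D with
    D a = a (x) a and D c = c (x) c automatically commutes with faces and with
    the products o, and it commutes with the differential as soon as
    d (D b) = c (x) c - a (x) a ([gmorph_is_Delta]).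

    If omega is rigid, D a and D c are forced by compatibility with the faces
    and with o on the unit, and D b is a combination of b (x) a, c (x) b,
    b (x) c and a (x) b, because its bidegree is (2, -1).  The equation for
    d (D b) is a linear system on the four coefficients whose solutions are
    exactly the x_t ([homog_partial2_eq]); multiplicativity then gives
    omega_n = x_t ^ (n - 1).  Conversely, for each t the multiplicative
    extension [Delta t] of a |-> a (x) a, b |-> x_t, c |-> c (x) c satisfies
    the criterion.  The Maurer-Cartan equation for omega_t is the image under
    [Delta t] of the same equation for the sequence of the L_n in Omega
    ([is_Delta_MC]), which is the Leibniz rule for b ^ (n - 1)
    ([partial_L]).

    The flip and the two iterated comultiplications are multiplicative as well,
    so symmetry and coassociativity only have to be tested on letters.  The
    flip carries x_t to x_(1 - t), whence t = 1/2.  In the two sides of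
    coassociativity at b, the coefficients of (b (x) c) (x) a are (1 - t) t
    and 0, whence t = 0 or t = 1, and at these two values the sides agree. *)

(** * Free modules: linear extension and supports *)

Section Free.
Context {R : realType}.
Implicit Types (X Y Z : choiceType) (V : lmodType R).

(** Homogeneity conditions are conditions on the words that occur in an element,
    so all of them are instances of this one predicate. *)
Definition supported X (P : X -> Prop) (x : {malg R[X]}) : Prop :=
  forall u, u \in msupp x -> P u.

Lemma supported0 X P : supported P (0 : {malg R[X]}).
Proof. by move=> u; rewrite msupp0 in_fset0. Qed.

Lemma supportedD X P (x y : {malg R[X]}) :
  supported P x -> supported P y -> supported P (x + y).
Proof.
move=> Px Py u /(fsubsetP (msuppD_le x y)).
by rewrite in_fsetU => /orP[/Px|/Py].
Qed.

Lemma supportedZ X P k (x : {malg R[X]}) :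
  supported P x -> supported P (k *: x).
Proof. by move=> Px u /(fsubsetP (msuppZ_le k x))/Px. Qed.

Lemma supportedU X (P : X -> Prop) u :
  P u -> supported P (<< u >> : {malg R[X]}).
Proof. by move=> Pu v; rewrite msuppU oner_eq0 in_fset1 => /eqP ->. Qed.

Lemma malg_basis X (x : {malg R[X]}) : x = \sum_(u <- msupp x) x@_u *: << u >>.
Proof.
rewrite {1}[x]monalgE; apply: eq_bigr => u _.
apply/malgP => v; rewrite mcoeffZ !mcoeffU.
by case: eqP => _; rewrite ?mulr1 ?mulr0.
Qed.

Lemma lextEw X V (f : X -> V) (x : {malg R[X]}) (d : {fset X}) :
  (msupp x `<=` d)%fset -> lext f x = \sum_(u <- d) x@_u *: f u.
Proof.
move=> le_xd; rewrite /lext (big_fset_incl _ le_xd) // => u _ xu.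
by rewrite mcoeff_outdom // scale0r.
Qed.

(** The defining sum of [lext f x] runs over the support of x, which varies with
    x; linearity is visible once all three sums run over a common finite set. *)
Fact lext_is_linear X V (f : X -> V) : linear (lext f).
Proof.
move=> k x y; set d := (msupp x `|` msupp y `|` msupp (k *: x + y))%fset.
have sub z : (msupp z `<=` d)%fset -> lext f z = \sum_(u <- d) z@_u *: f u.
  exact: lextEw.
have xd : (msupp x `<=` d)%fset by rewrite /d -fsetUA fsubsetUl.
have yd : (msupp y `<=` d)%fset by rewrite /d fsetUAC fsubsetUr.
rewrite !sub ?fsubsetUr //.
rewrite scaler_sumr -big_split; apply: eq_bigr => u _ /=.
by rewrite mcoeffD mcoeffZ scalerDl scalerA.
Qed.

HB.instance Definition _ X V (f : X -> V) :=
  GRing.isLinear.Build R {malg R[X]} V _ (lext f) (lext_is_linear f).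

Lemma bext_lext X Y V (f : X -> Y -> V) (x : {malg R[X]}) (y : {malg R[Y]}) :
  bext f x y = lext (fun u => lext (f u) y) x.
Proof.
rewrite /bext /lext; apply: eq_bigr => u _.
by rewrite scaler_sumr; apply: eq_bigr => v _; rewrite scalerA.
Qed.

Lemma bext_lextC X Y V (f : X -> Y -> V) (x : {malg R[X]}) (y : {malg R[Y]}) :
  bext f x y = lext (fun v => lext (f ^~ v) x) y.
Proof.
rewrite /bext /lext exchange_big; apply: eq_bigr => v _.
by rewrite scaler_sumr; apply: eq_bigr => u _; rewrite scalerA mulrC.
Qed.

Fact bext_is_bilinear X Y V (f : X -> Y -> V) :
  bilinear_for *:%R *:%R (bext f).
Proof.
split=> [y k x x'|x k y y']; first by rewrite !bext_lext linearP.
by rewrite !bext_lextC linearP.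
Qed.

HB.instance Definition _ X Y V (f : X -> Y -> V) :=
  bilinear_isBilinear.Build R {malg R[X]} {malg R[Y]} V _ _ (bext f)
    (bext_is_bilinear f).
HB.instance Definition _ X Y V (f : X -> Y -> V) x :=
  GRing.isLinear.Build R {malg R[Y]} V _ (bext f x) ((bext_is_bilinear f).2 x).

Lemma eq_bext X Y V (f g : X -> Y -> V) : f =2 g -> bext f =2 bext g.
Proof.
by move=> fg x y; apply: eq_bigr => u _; apply: eq_bigr => v _; rewrite fg.
Qed.

(** The induction principle by which an identity linear in one argument is
    reduced to basis words of the shape prescribed by P. *)
Lemma supported_ind X (P : X -> Prop) (Q : {malg R[X]} -> Prop) :
    Q 0 -> (forall k x y, Q x -> Q y -> Q (k *: x + y)) ->
    (forall u, P u -> Q << u >>) ->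
  forall x, supported P x -> Q x.
Proof.
move=> Q0 QP QU x Px; rewrite (malg_basis x) big_seq.
by apply: big_rec => // u y /Px/QU Qu Qy; apply: QP.
Qed.

Lemma malg_ind X (Q : {malg R[X]} -> Prop) :
    Q 0 -> (forall k x y, Q x -> Q y -> Q (k *: x + y)) ->
    (forall u, Q << u >>) -> forall x, Q x.
Proof.
by move=> Q0 QP QU x; apply: (@supported_ind X (fun=> True)) => // u _.
Qed.

Lemma supported_linear X Y (P : X -> Prop) (Q : Y -> Prop)
    (f : {linear {malg R[X]} -> {malg R[Y]}}) x :
  supported P x -> (forall u, P u -> supported Q (f << u >>)) ->
  supported Q (f x).
Proof.
move=> Px fQ; elim/supported_ind: x / Px => [|k x y Qx Qy|u Pu].
- by rewrite linear0; apply: supported0.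
- by rewrite linearP; apply: supportedD => //; apply: supportedZ.
- exact: fQ.
Qed.

Lemma supported_bext X Y Z (P : X -> Prop) (Q : Y -> Prop) (S : Z -> Prop)
    (f : X -> Y -> {malg R[Z]}) x y :
  supported P x -> supported Q y ->
  (forall u v, P u -> Q v -> supported S (f u v)) -> supported S (bext f x y).
Proof.
move=> Px Qy fS; rewrite bext_lext; apply: (supported_linear Px) => u Pu.
rewrite /= lextU; apply: (supported_linear Qy) => v Qv; rewrite /= lextU.
exact: fS.
Qed.

(** * Concatenation twisted by signs *)

Definition odd_int (d : int) : bool := odd `|d|%N.

Lemma odd_intD d e : odd_int (d + e) = odd_int d (+) odd_int e.
Proof.
by rewrite /odd_int; case: d => d; case: e => e; lia.
Qed.

Lemma signz d : (-1) ^ d = (-1) ^+ odd_int d :> R.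
Proof. by rewrite expN1r signr_odd. Qed.

Lemma signzM d e : (-1) ^ (d * e) = (-1) ^+ (odd_int d && odd_int e) :> R.
Proof. by rewrite signz /odd_int abszM oddM. Qed.

(** The data from which a signed concatenation product on words is built. The
    sign exponent [tw u v] is a bimultiplicative cocycle, which is what makes
    the product associative; the degree is carried along because it enters the
    cocycle of a tensor product ([boxtw]). Tensor powers therefore never leave
    this class, and one theory covers Omega and its second and third powers. *)
Record twist X := Twist {
  tw : seq X -> seq X -> bool;
  deg : seq X -> int;
  twDl : forall u u' v, tw (u ++ u') v = tw u v (+) tw u' v;
  twDr : forall u v v', tw u (v ++ v') = tw u v (+) tw u v';
  degD : forall u u', deg (u ++ u') = deg u + deg u'
}.

Definition par X (T : twist X) u := odd_int (deg T u).

Lemma parD X (T : twist X) u v : par T (u ++ v) = par T u (+) par T v.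
Proof. by rewrite /par degD odd_intD. Qed.

Lemma deg0 X (T : twist X) : deg T [::] = 0.
Proof.
have /eqP := degD T [::] [::].
by rewrite -subr_eq0 opprD addNKr oppr_eq0 => /eqP.
Qed.

Lemma tw0l X (T : twist X) u : tw T [::] u = false.
Proof. by have := twDl T [::] [::] u; case: (tw T _ _). Qed.

Lemma tw0r X (T : twist X) u : tw T u [::] = false.
Proof. by have := twDr T u [::] [::]; case: (tw T _ _). Qed.

Definition tprod X (T : twist X) :
    {malg R[seq X]} -> {malg R[seq X]} -> {malg R[seq X]} :=
  bext (fun u v => (-1) ^+ tw T u v *: << u ++ v >>).

HB.instance Definition _ X (T : twist X) := Bilinear.copy (tprod T) (bext _).
HB.instance Definition _ X (T : twist X) x :=
  GRing.Linear.copy (tprod T x) (bext _ x).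

Lemma tprodU X (T : twist X) u v :
  tprod T << u >> << v >> = (-1) ^+ tw T u v *: << u ++ v >>.
Proof. exact: bextU. Qed.

Lemma tprod1l X (T : twist X) x : tprod T << [::] >> x = x.
Proof.
elim/malg_ind: x => [|k x y IHx IHy|u]; first by rewrite linear0r.
  by rewrite linearPr /= IHx IHy.
by rewrite tprodU tw0l scale1r.
Qed.

Lemma tprod1r X (T : twist X) x : tprod T x << [::] >> = x.
Proof.
elim/malg_ind: x => [|k x y IHx IHy|u]; first by rewrite linear0l.
  by rewrite linearPl /= IHx IHy.
by rewrite tprodU tw0r scale1r cats0.
Qed.

Lemma tprodA X (T : twist X) : associative (@tprod X T).
Proof.
move=> x y z; elim/malg_ind: x => [|k x x' IHx IHx'|u].
- by rewrite !linear0l.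
- by rewrite !linearPl /= IHx IHx'.
elim/malg_ind: y => [|k y y' IHy IHy'|v].
- by rewrite linear0l !linear0r linear0l.
- by rewrite linearPl !linearPr linearPl /= IHy IHy'.
elim/malg_ind: z => [|k z z' IHz IHz'|w]; first by rewrite !linear0r.
  by rewrite !linearPr /= IHz IHz'.
rewrite !tprodU linearZr_LR linearZl_LR /= !tprodU !scalerA catA twDl twDr.
by rewrite -!signr_addb; do 3!case: (tw _ _ _).
Qed.

Lemma size_unzip1 X Y (w : seq (X * Y)) : size (unzip1 w) = size w.
Proof. exact: size_map. Qed.
Lemma size_unzip2 X Y (w : seq (X * Y)) : size (unzip2 w) = size w.
Proof. exact: size_map. Qed.

Section BoxTwist.
Variables (X Y : choiceType) (S : twist X) (T : twist Y).

(** The Koszul rule: in (u1 (x) u2)(v1 (x) v2) the factor u2 moves past v1,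
    which contributes the sign (-1)^(|u2| |v1|). *)
Definition boxtw_tw (w w' : seq (X * Y)) :=
  tw S (unzip1 w) (unzip1 w') (+) tw T (unzip2 w) (unzip2 w')
  (+) (par T (unzip2 w) && par S (unzip1 w')).
Definition boxtw_deg (w : seq (X * Y)) := deg S (unzip1 w) + deg T (unzip2 w).

Fact boxtw_twDl u u' v :
  boxtw_tw (u ++ u') v = boxtw_tw u v (+) boxtw_tw u' v.
Proof.
rewrite /boxtw_tw /unzip1 /unzip2 !map_cat !twDl parD.
by do 4!case: (tw _ _ _); do 3!case: (par _ _).
Qed.

Fact boxtw_twDr u v v' :
  boxtw_tw u (v ++ v') = boxtw_tw u v (+) boxtw_tw u v'.
Proof.
rewrite /boxtw_tw /unzip1 /unzip2 !map_cat !twDr parD.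
by do 4!case: (tw _ _ _); do 3!case: (par _ _).
Qed.

Fact boxtw_degD u u' : boxtw_deg (u ++ u') = boxtw_deg u + boxtw_deg u'.
Proof. by rewrite /boxtw_deg /unzip1 /unzip2 !map_cat !degD addrACA. Qed.

Definition boxtw := Twist boxtw_twDl boxtw_twDr boxtw_degD.
End BoxTwist.

HB.instance Definition _ X Y := Bilinear.copy (@box R X Y) (bext _).
HB.instance Definition _ X Y x := GRing.Linear.copy (@box R X Y x) (bext _ x).

Lemma boxU X Y (u : seq X) (v : seq Y) :
  size u = size v -> box << u >> << v >> = << zip u v >> :> {malg R[_]}.
Proof. by move=> Euv; rewrite /box bextU Euv eqxx. Qed.

Lemma box_unzip X Y (w : seq (X * Y)) :
  box << unzip1 w >> << unzip2 w >> = << w >> :> {malg R[_]}.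
Proof. by rewrite boxU ?zip_unzip // !size_map. Qed.

End Free.

(** * Homogeneous elements and graded morphisms *)

Section Morphisms.
Context {R : realType}.
Implicit Types X Y Z : choiceType.

Section Bilinearity.
Variables (X Y : choiceType) (T : twist X).
Implicit Types (x : {malg R[seq X]}) (y : {malg R[seq Y]}).

Lemma tprodDl x1 x2 x : tprod T (x1 + x2) x = tprod T x1 x + tprod T x2 x.
Proof. exact: linearDl. Qed.
Lemma tprodDr x x1 x2 : tprod T x (x1 + x2) = tprod T x x1 + tprod T x x2.
Proof. exact: linearDr. Qed.
Lemma tprodZl k x1 x2 : tprod T (k *: x1) x2 = k *: tprod T x1 x2.
Proof. exact: linearZl_LR. Qed.
Lemma tprodZr k x1 x2 : tprod T x1 (k *: x2) = k *: tprod T x1 x2.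
Proof. exact: linearZr_LR. Qed.
Lemma tprod0l x : tprod T 0 x = 0.
Proof. exact: linear0l. Qed.
Lemma tprod0r x : tprod T x 0 = 0.
Proof. exact: linear0r. Qed.
Lemma boxDl x1 x2 y : box (x1 + x2) y = box x1 y + box x2 y.
Proof. exact: linearDl. Qed.
Lemma boxDr x y1 y2 : box x (y1 + y2) = box x y1 + box x y2.
Proof. exact: linearDr. Qed.
Lemma boxZl k x y : box (k *: x) y = k *: box x y.
Proof. exact: linearZl_LR. Qed.
Lemma boxZr k x y : box x (k *: y) = k *: box x y.
Proof. exact: linearZr_LR. Qed.
Lemma box0l y : box (0 : {malg R[seq X]}) y = 0.
Proof. exact: linear0l. Qed.
Lemma box0r x : box x (0 : {malg R[seq Y]}) = 0.
Proof. exact: linear0r. Qed.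
End Bilinearity.

Definition tprod_bilinear := (tprodDl, tprodDr, tprodZl, tprodZr).
Definition box_bilinear := (boxDl, boxDr, boxZl, boxZr).

Definition homog X (T : twist X) (m : nat) (d : int) :
    {malg R[seq X]} -> Prop :=
  supported (fun u => size u = m /\ deg T u = d).

Lemma homogU X (T : twist X) u : homog T (size u) (deg T u) << u >>.
Proof. exact: supportedU. Qed.

Lemma homog_tprod X (T : twist X) m n d e x y :
  homog T m d x -> homog T n e y -> homog T (m + n) (d + e) (tprod T x y).
Proof.
move=> hx hy; apply: (supported_bext hx hy) => u v [<- <-] [<- <-].
by apply: supportedZ; apply: supportedU; rewrite size_cat degD.
Qed.

Lemma homog_box X Y (S : twist X) (T : twist Y) m d e x y :
  homog S m d x -> homog T m e y -> homog (boxtw S T) m (d + e) (box x y).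
Proof.
move=> hx hy; apply: (supported_bext hx hy) => u v [Eu <-] [Ev <-].
rewrite Eu Ev eqxx; apply: supportedU.
by rewrite size_zip /= /boxtw_deg unzip1_zip ?unzip2_zip Eu Ev ?minnn.
Qed.

(** The interchange law between the tensor product and the twisted products.
    Equal arities in each factor are essential: [box] vanishes on words of
    different lengths, although their concatenations may have equal lengths. *)
Lemma box_tprod X Y (S : twist X) (T : twist Y) m n d d' e e' x x' y y' :
    homog S m d x -> homog S n d' x' -> homog T m e y -> homog T n e' y' ->
  box (tprod S x x') (tprod T y y') =
    (-1) ^+ (odd_int e && odd_int d') *:
    tprod (boxtw S T) (box x y) (box x' y').
Proof.
move=> Px Px' Py Py'.
elim/(@supported_ind R): x / Px => [|k x1 x2 IH1 IH2|u [Eu _]].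
- by rewrite tprod0l !box0l tprod0l scaler0.
- rewrite tprodDl tprodZl !boxDl !boxZl tprodDl tprodZl IH1 IH2.
  by rewrite scalerDr !scalerA mulrC.
elim/(@supported_ind R): x' / Px' => [|k x1 x2 IH1 IH2|u' [Eu' <-]].
- by rewrite tprod0r !box0l tprod0r scaler0.
- rewrite tprodDr tprodZr !boxDl !boxZl tprodDr tprodZr IH1 IH2.
  by rewrite scalerDr !scalerA mulrC.
elim/(@supported_ind R): y / Py => [|k y1 y2 IH1 IH2|v [Ev <-]].
- by rewrite tprod0l !box0r tprod0l scaler0.
- rewrite tprodDl tprodZl !boxDr !boxZr tprodDl tprodZl IH1 IH2.
  by rewrite scalerDr !scalerA mulrC.
elim/(@supported_ind R): y' / Py' => [|k y1 y2 IH1 IH2|v' [Ev' _]].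
- by rewrite tprod0r !box0r tprod0r scaler0.
- rewrite tprodDr tprodZr !boxDr !boxZr tprodDr tprodZr IH1 IH2.
  by rewrite scalerDr !scalerA mulrC.
have Euv : size u = size v by rewrite Eu.
have Euv' : size u' = size v' by rewrite Eu'.
rewrite !tprodU linearZl_LR linearZr_LR /= !boxU ?size_cat ?Euv ?Euv' //.
rewrite tprodU !scalerA zip_cat //= /boxtw_tw /par.
rewrite !unzip1_zip ?Euv ?Euv' // !unzip2_zip ?Euv ?Euv' //.
by rewrite -!signr_addb [(_ && _) (+) _]addbC addbK.
Qed.

(** The next two identities are stated in an arbitrary module, where they are
    pure bookkeeping of coefficients. *)
Lemma scalerDACA (V : lmodType R) (k s : R) (a b c d : V) :
  k *: (a + s *: b) + (c + s *: d) = (k *: a + c) + s *: (k *: b + d).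
Proof. by rewrite !scalerDr !scalerA addrACA mulrC. Qed.

Lemma leibniz_signs (V : lmodType R) (i j k : bool) (t1 t2 t3 t4 : V) :
  (-1) ^+ (k && j) *:
    ((-1) ^+ (k && j) *: t1 + (-1) ^+ i *: ((-1) ^+ (k && ~~ j) *: t2)
     + (-1) ^+ (i (+) j) *:
       ((-1) ^+ (~~ k && j) *: t3 + (-1) ^+ k *: ((-1) ^+ (k && j) *: t4))) =
  t1 + (-1) ^+ i *: t3 + (-1) ^+ (i (+) k) *: (t2 + (-1) ^+ j *: t4).
Proof.
rewrite !scalerDr !scalerA addrACA -!signr_addb addbb scale1r.
by case: i; case: j; case: k.
Qed.

(** Why d (x) 1 + 1 (x) d is a derivation of the tensor product of two
    algebras when d is a derivation of each: dp, du, dq, dv stand for the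
    differentials of p, u, q, v.  The interchange law produces a sign for each
    of the four terms, and the signs match case by case. *)
Lemma box_leibniz X Y (S : twist X) (T : twist Y) m n (i j k l : int)
    (p dp u du : {malg R[seq X]}) (q dq v dv : {malg R[seq Y]}) :
    homog S m i p -> homog S m (i + 1) dp ->
    homog S n j u -> homog S n (j + 1) du ->
    homog T m k q -> homog T m (k + 1) dq ->
    homog T n l v -> homog T n (l + 1) dv ->
  (-1) ^+ (odd_int k && odd_int j) *:
    (box (tprod S dp u + (-1) ^+ odd_int i *: tprod S p du) (tprod T q v)
     + (-1) ^+ (odd_int (i + j)) *:
       box (tprod S p u) (tprod T dq v + (-1) ^+ odd_int k *: tprod T q dv)) =
  tprod (boxtw S T) (box dp q + (-1) ^+ odd_int i *: box p dq) (box u v)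
  + (-1) ^+ odd_int (i + k) *:
    tprod (boxtw S T) (box p q) (box du v + (-1) ^+ odd_int j *: box u dv).
Proof.
move=> hp hdp hu hdu hq hdq hv hdv.
rewrite !box_bilinear !tprod_bilinear.
rewrite (box_tprod hdp hu hq hv) (box_tprod hp hdu hq hv).
rewrite (box_tprod hp hu hdq hv) (box_tprod hp hu hq hdv).
move: (tprod _ (box dp q) _) (tprod _ (box p q) (box du v)) => t1 t2.
move: (tprod _ (box p dq) _) (tprod _ (box p q) (box u dv)) => t3 t4.
have odd1 d : odd_int (d + 1) = ~~ odd_int d by rewrite odd_intD addbT.
by rewrite !odd1 (odd_intD i j) (odd_intD i k) leibniz_signs.
Qed.

(** Unital algebra morphisms that preserve arity and degree. The conditions
    are imposed on basis words only, so that they make sense for the functions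
    fed to [boxmap], of which only the values on basis words matter. *)
Record gmorph X Y (S : twist X) (T : twist Y)
    (f : {malg R[seq X]} -> {malg R[seq Y]}) : Prop := {
  gmorph_unit : f << [::] >> = << [::] >>;
  gmorph_cat : forall u v,
    f << u ++ v >> = (-1) ^+ tw S u v *: tprod T (f << u >>) (f << v >>);
  gmorph_homog : forall u, homog T (size u) (deg S u) (f << u >>)
}.

Lemma gmorphM X Y (S : twist X) (T : twist Y)
    (f : {linear {malg R[seq X]} -> {malg R[seq Y]}}) x y :
  gmorph S T f -> f (tprod S x y) = tprod T (f x) (f y).
Proof.
move=> fM; elim/(@malg_ind R): x => [|k x x' IHx IHx'|u].
- by rewrite linear0l linear0 linear0l.
- by rewrite linearPl !linearP /= IHx IHx' linearPl.
elim/(@malg_ind R): y => [|k y y' IHy IHy'|v].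
- by rewrite linear0r linear0 linear0r.
- by rewrite !linearP /= IHy IHy'.
by rewrite tprodU linearZ_LR (gmorph_cat fM) scalerA -signr_addb addbb scale1r.
Qed.

Lemma eq_gmorph X Y (S : twist X) (T : twist Y)
    (f g : {linear {malg R[seq X]} -> {malg R[seq Y]}}) :
  gmorph S T f -> gmorph S T g ->
  (forall x, f << [:: x] >> = g << [:: x] >>) -> f =1 g.
Proof.
move=> fM gM fg; apply: malg_ind => [|k x y IHx IHy|u].
- by rewrite !linear0.
- by rewrite !linearP IHx IHy.
elim: u => [|x u IHu]; first by rewrite (gmorph_unit fM) (gmorph_unit gM).
by rewrite -cat1s (gmorph_cat fM) (gmorph_cat gM) fg IHu.
Qed.

Lemma gmorph_comp X Y Z (S : twist X) (T : twist Y) (U : twist Z)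
    (g : {linear {malg R[seq Y]} -> {malg R[seq Z]}}) f :
  gmorph S T f -> gmorph T U g -> gmorph S U (g \o f).
Proof.
move=> fM gM; split=> [|u v|u] /=.
- by rewrite (gmorph_unit fM) (gmorph_unit gM).
- by rewrite (gmorph_cat fM) linearZ_LR (gmorphM _ _ gM).
apply: (supported_linear (@gmorph_homog _ _ _ _ _ fM u)) => v [<- <-].
exact: (gmorph_homog gM).
Qed.

Lemma gmorph_id X (T : twist X) : gmorph T T id.
Proof.
split=> // [u v|u]; last exact: homogU.
by rewrite tprodU scalerA -signr_addb addbb scale1r.
Qed.

HB.instance Definition _ X Y X' Y' f g :=
  GRing.Linear.copy (@boxmap R X Y X' Y' f g) (lext _).

Lemma boxmapU X Y X' Y' (f : {malg R[seq X]} -> {malg R[seq X']})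
    (g : {malg R[seq Y]} -> {malg R[seq Y']}) w :
  boxmap f g << w >> = box (f << unzip1 w >>) (g << unzip2 w >>).
Proof. exact: lextU. Qed.

(** The tensor product of two morphisms is a morphism: the Koszul sign depends
    only on degrees, which both morphisms preserve. *)
Lemma gmorph_boxmap X Y X' Y' (S : twist X) (T : twist Y) (S' : twist X')
    (T' : twist Y') (f : {malg R[seq X]} -> {malg R[seq X']})
    (g : {malg R[seq Y]} -> {malg R[seq Y']}) :
  gmorph S S' f -> gmorph T T' g ->
  gmorph (boxtw S T) (boxtw S' T') (boxmap f g).
Proof.
move=> fM gM.
have hf w : homog S' (size w) (deg S (unzip1 w)) (f << @unzip1 X Y w >>).
  by rewrite -(size_unzip1 w); apply: (gmorph_homog fM).
have hg w : homog T' (size w) (deg T (unzip2 w)) (g << @unzip2 X Y w >>).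
  by rewrite -(size_unzip2 w); apply: (gmorph_homog gM).
split=> [|u v|u]; rewrite ?boxmapU.
- by rewrite /= (gmorph_unit fM) (gmorph_unit gM) boxU.
- rewrite {1}/unzip1 {1}/unzip2 !map_cat (gmorph_cat fM) (gmorph_cat gM).
  rewrite linearZl_LR linearZr_LR /= (box_tprod (hf u) (hf v) (hg u) (hg v)).
  by rewrite !scalerA -!signr_addb /boxtw_tw /par.
exact: homog_box.
Qed.

HB.instance Definition _ X Y Z :=
  GRing.Linear.copy (@box_assoc R X Y Z) (lext _).

(** Both bracketings give the sign exponent
    |u2| |v1| + |u3| |v1| + |u3| |v2|, besides the twists of the factors. *)
Lemma gmorph_box_assoc X Y Z (S : twist X) (T : twist Y) (U : twist Z) :
  gmorph (boxtw S (boxtw T U)) (boxtw (boxtw S T) U) (@box_assoc R X Y Z).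
Proof.
pose r (w : seq (X * (Y * Z))) := [seq ((p.1, p.2.1), p.2.2) | p <- w].
have e1 w : unzip1 (unzip1 (r w)) = unzip1 w.
  by rewrite /unzip1 -!map_comp; apply: eq_map.
have e2 w : unzip2 (unzip1 (r w)) = unzip1 (unzip2 w).
  by rewrite /unzip1 /unzip2 -!map_comp; apply: eq_map.
have e3 w : unzip2 (r w) = unzip2 (unzip2 w).
  by rewrite /unzip2 -!map_comp; apply: eq_map.
have rU w : box_assoc << w >> = << r w >> :> {malg R[_]} by exact: lextU.
split=> [|u v|u]; rewrite ?rU //.
  rewrite /r map_cat -!/(r _) tprodU scalerA -signr_addb.
  rewrite /= /boxtw_tw /= /boxtw_tw /par /= /boxtw_deg !e1 !e2 !e3 !odd_intD.
  rewrite -[LHS]scale1r; congr (_ *: _).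
  by do 3!case: (tw _ _ _); do 4!case: (odd_int _).
apply: supportedU; rewrite size_map /= /boxtw_deg /= /boxtw_deg.
by rewrite e1 e2 e3 addrA.
Qed.

(** With [lext], the extension of a map on letters to a morphism from a free
    algebra. *)
Definition wext X Y (T : twist Y) (g : X -> {malg R[seq Y]}) (w : seq X) :=
  foldr (fun x => tprod T (g x)) << [::] >> w.

Lemma gmorph_wext X Y (S : twist X) (T : twist Y) (g : X -> {malg R[seq Y]}) :
  (forall u v, tw S u v = false) ->
  (forall x, homog T 1 (deg S [:: x]) (g x)) ->
  gmorph S T (lext (wext T g)).
Proof.
move=> S0 hg; split=> [|u v|u]; rewrite ?lextU //.
  rewrite S0 scale1r; elim: u => [|x u IHu] /=; first by rewrite tprod1l.
  by rewrite IHu tprodA.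
elim: u => [|x u IHu] /=; first by apply: supportedU; rewrite !deg0.
by rewrite -cat1s degD -add1n; apply: homog_tprod.
Qed.

End Morphisms.

Arguments gmorph_homog {R X Y S T f} _ u : rename.

(** * The structure maps in terms of the twisted products *)

Lemma ldeg_cat u v : ldeg (u ++ v) = ldeg u + ldeg v.
Proof. by rewrite /ldeg count_cat PoszD opprD. Qed.

Definition letterT : twist letter :=
  @Twist letter (fun _ _ => false) ldeg
    (fun _ _ _ => erefl) (fun _ _ _ => erefl) ldeg_cat.

Definition letter2T : twist (letter * letter)%type := boxtw letterT letterT.

Section Structure.
Context {R : realType}.
Local Notation Om := (Omega R).
Local Notation Om2 := (Omega2 R).

HB.instance Definition _ := Bilinear.copy (@circ2 R) (bext _).
HB.instance Definition _ x := GRing.Linear.copy (@circ2 R x) (bext _ x).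
HB.instance Definition _ i := GRing.Linear.copy (@face R i) (lext _).
HB.instance Definition _ i := GRing.Linear.copy (@face2 R i) (lext _).
HB.instance Definition _ := GRing.Linear.copy (@partial R) (lext _).
HB.instance Definition _ := GRing.Linear.copy (@partial2 R) (lext _).
HB.instance Definition _ := GRing.Linear.copy (@flip R) (lext _).

Lemma diaE (x y : Om) : dia x y = tprod letterT x y.
Proof. by apply: eq_bext => u v /=; rewrite scale1r. Qed.

Lemma dia2E (x y : Om2) : dia2 x y = tprod letter2T x y.
Proof.
apply: eq_bext => u v; rewrite signzM /dia !bextU boxU; last first.
  by rewrite !size_cat !size_map.
rewrite /= /boxtw_tw /par /=.
by rewrite /unzip1 /unzip2 -!map_cat zip_unzip.
Qed.

Lemma unit2E : unit2 = << [::] >> :> Om2.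
Proof. exact: boxU. Qed.

Lemma cons_tprod x w :
  << x :: w >> = tprod letterT << [:: x] >> << w >> :> Om.
Proof. by rewrite tprodU scale1r. Qed.

Lemma circE (x y : Om) : circ x y = tprod letterT (tprod letterT x c_) y.
Proof. by rewrite /circ !diaE. Qed.

(** No sign separates [circ2] from the product with c (x) c in the middle, as
    that letter has degree 0. *)
Lemma circ2E (x y : Om2) :
  circ2 x y = tprod letter2T (tprod letter2T x << [:: (Lc, Lc)] >>) y.
Proof.
elim/(@malg_ind R): x => [|k x x' IHx IHx'|u].
- by rewrite !linear0l.
- by rewrite !linearPl /= IHx IHx'.
elim/(@malg_ind R): y => [|k y y' IHy IHy'|v].
- by rewrite !linear0r.
- by rewrite !linearPr /= IHy IHy'.
rewrite /circ2 bextU !circE !tprodU !scale1r !tprodU !scale1r signzM.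
rewrite boxU; last by rewrite !size_cat !size_map.
have cl : tw letter2T [:: (Lc, Lc)] v = false by [].
have cr : tw letter2T u [:: (Lc, Lc)] = false by rewrite /= /boxtw_tw /= andbF.
rewrite cr scale1r tprodU twDl cl addbF.
by rewrite -!catA !zip_cat ?size_map // !zip_unzip.
Qed.

Lemma homog_bidegree2 (k : nat) l (x : Om2) :
  of_bidegree ldeg2 k.+1 l x <-> homog letter2T k l x.
Proof.
by split=> hx u /hx[Eu El]; split=> //; [case: Eu | rewrite /kdeg Eu].
Qed.

Lemma faceU i w : face i << w >> = << insert_a i w >> :> Om.
Proof. exact: lextU. Qed.

Lemma face2U i w :
  face2 i << w >> = << take i.-1 w ++ (La, La) :: drop i.-1 w >> :> Om2.
Proof.
rewrite /face2 lextU !faceU /insert_a boxU; last first.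
  by rewrite !size_cat /= !size_take !size_drop !size_map.
rewrite /unzip1 /unzip2 zip_cat ?size_take ?size_map //=.
by rewrite -!map_take -!map_drop !zip_unzip.
Qed.

(** Inserting a (x) a further to the right leaves the first letter alone; no
    sign appears because a (x) a is even. *)
Lemma face2_cons (i : nat) p (y : Om2) :
  face2 i.+2 (tprod letter2T << [:: p] >> y) =
    tprod letter2T << [:: p] >> (face2 i.+1 y).
Proof.
elim/(@malg_ind R): y => [|k y y' IHy IHy'|v].
- by rewrite !(linear0, linear0r).
- by rewrite !(linearP, linearPr) /= IHy IHy'.
rewrite tprodU linearZ_LR face2U tprodU.
congr ((-1) ^+ nat_of_bool _ *: _); last exact: face2U.
have ta : tw letter2T [:: p] [:: (La, La)] = false.
  by rewrite /= /boxtw_tw /= andbF.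
by rewrite -[_ :: drop _ _]cat1s !twDr ta -twDr cat_take_drop.
Qed.

Lemma face2_1 (y : Om2) : face2 1 y = tprod letter2T << [:: (La, La)] >> y.
Proof.
elim/(@malg_ind R): y => [|k y y' IHy IHy'|v].
- by rewrite !(linear0, linear0r).
- by rewrite !(linearP, linearPr) /= IHy IHy'.
by rewrite face2U tprodU /= take0 drop0 /= scale1r.
Qed.

Lemma homog_partial_letter x :
  homog letterT 1 (ldeg [:: x] + 1) (partial_letter x : Om).
Proof.
case: x => /=; try exact: supported0.
apply: supportedD; first exact: supportedU.
by rewrite -scaleN1r; apply: supportedZ; apply: supportedU.
Qed.

Lemma homog_partial_word w :
  homog letterT (size w) (ldeg w + 1) (partial_word w : Om).
Proof.
elim: w => [|x w IHw] /=; first exact: supported0.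
rewrite -cat1s ldeg_cat !diaE -add1n; apply: supportedD.
  rewrite addrAC; apply: homog_tprod; last exact: homogU.
  exact: homog_partial_letter.
by apply: supportedZ; rewrite -addrA; apply: homog_tprod => //; apply: homogU.
Qed.

Lemma partial2U w : partial2 << w >> =
    box (partial << unzip1 w >>) << unzip2 w >>
    + (-1) ^+ par letterT (unzip1 w) *:
      box << unzip1 w >> (partial << unzip2 w >>) :> Om2.
Proof. by rewrite /partial2 lextU signz. Qed.

Lemma partial2D (x y : Om2) : partial2 (x + y) = partial2 x + partial2 y.
Proof. exact: linearD. Qed.

Lemma partial2Z (k : R) (x : Om2) : partial2 (k *: x) = k *: partial2 x.
Proof. exact: linearZ_LR. Qed.

Lemma face2P i (k : R) (x y : Om2) :
  face2 i (k *: x + y) = k *: face2 i x + face2 i y.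
Proof. exact: linearP. Qed.

Lemma partialU w : partial << w >> = partial_word w :> Om.
Proof. exact: lextU. Qed.

Lemma partial_cons x w : partial << x :: w >> =
    tprod letterT (partial_letter x) << w >>
    + (-1) ^+ par letterT [:: x] *:
      tprod letterT << [:: x] >> (partial << w >>) :> Om.
Proof. by rewrite !partialU /= !diaE signz. Qed.

Lemma homog_partial w :
  homog letterT (size w) (ldeg w + 1) (partial << w >> : Om).
Proof. by rewrite partialU; apply: homog_partial_word. Qed.

Lemma partial_letterE x : partial << [:: x] >> = partial_letter x :> Om.
Proof. by rewrite partial_cons tprod1r partialU /= tprod0r scaler0 addr0. Qed.

Lemma partial2_letter p q : partial2 << [:: (p, q)] >> =
    box (partial_letter p) << [:: q] >>
    + (-1) ^+ par letterT [:: p] *: box << [:: p] >> (partial_letter q) :> Om2.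
Proof. by rewrite partial2U -!partial_letterE. Qed.

(** The Leibniz rule for a first factor consisting of one letter, which is all
    that an induction on words requires. *)
Lemma partial2_cons p (y : Om2) :
  partial2 (tprod letter2T << [:: p] >> y) =
    tprod letter2T (partial2 << [:: p] >>) y
    + (-1) ^+ par letter2T [:: p] *: tprod letter2T << [:: p] >> (partial2 y).
Proof.
elim/(@malg_ind R): y => [|k y y' IHy IHy'|w].
- by rewrite !(tprod0r, linear0) addr0.
- rewrite !(tprodDr, tprodZr, partial2D, partial2Z) IHy IHy'.
  exact: scalerDACA.
case: p => p q.
have hl x : homog letterT 1 (ldeg [:: x]) (<< [:: x] >> : Om).
  exact: (@homogU R).
have hp := homog_partial_letter.
have hw1 : homog letterT (size w) (ldeg (unzip1 w)) (<< unzip1 w >> : Om).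
  by rewrite -(size_unzip1 w); apply: homogU.
have hw2 : homog letterT (size w) (ldeg (unzip2 w)) (<< unzip2 w >> : Om).
  by rewrite -(size_unzip2 w); apply: homogU.
have hd1 : homog letterT (size w) (ldeg (unzip1 w) + 1)
    (partial << unzip1 w >> : Om).
  by rewrite -(size_unzip1 w); apply: homog_partial.
have hd2 : homog letterT (size w) (ldeg (unzip2 w) + 1)
    (partial << unzip2 w >> : Om).
  by rewrite -(size_unzip2 w); apply: homog_partial.
have := box_leibniz (hl p) (hp p) hw1 hd1 (hl q) (hp q) hw2 hd2.
rewrite -!partial_cons -!cons_tprod -!partial_letterE -ldeg_cat.
have -> : box << [:: p] >> << [:: q] >> = << [:: (p, q)] >> :> Om2.
  exact: (box_unzip [:: (p, q)]).
rewrite (box_unzip w) tprodU partial2Z.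
rewrite -[[:: (p, q)] ++ w]/((p, q) :: w) (partial2U ((p, q) :: w)).
by rewrite (partial2U [:: (p, q)]) (partial2U w).
Qed.

End Structure.

(** * Morphisms determined by their values on letters *)

Section Comultiplication.
Context {R : realType}.
Local Notation Om := (Omega R).
Local Notation Om2 := (Omega2 R).
Implicit Types (t : R) (D : {linear Om -> Om2}).

Lemma partial2_tprod d (z y : Om2) : homog letter2T 1 d z ->
  partial2 (tprod letter2T z y) =
    tprod letter2T (partial2 z) y
    + (-1) ^+ odd_int d *: tprod letter2T z (partial2 y).
Proof.
move=> hz; elim/(@supported_ind R): z / hz
  => [|k z z' IHz IHz'|[|p [|p' u]] [] //= _ <-].
- by rewrite linear0 !tprod0l linear0 scaler0 addr0.
- rewrite !(tprodDl, tprodZl, partial2D, partial2Z) IHz IHz'.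
  exact: scalerDACA.
exact: partial2_cons.
Qed.

Lemma face2_tprod i d (z y : Om2) : homog letter2T 1 d z ->
  face2 i.+2 (tprod letter2T z y) = tprod letter2T z (face2 i.+1 y).
Proof.
move=> hz; elim/(@supported_ind R): z / hz
  => [|k z z' IHz IHz'|[|p [|p' u]] [] //= _ _].
- by rewrite !tprod0l linear0.
- by rewrite !(tprodDl, tprodZl, face2P) IHz IHz'.
exact: face2_cons.
Qed.

(** A graded morphism with grouplike a and c and with the right differential
    on b is a map Delta_omega, with omega formed by the images of the L n. *)
Section FromLetters.
Variable D : {linear Om -> Om2}.
Hypothesis DM : gmorph letterT letter2T D.

Lemma gmorph_cons x u :
  D << x :: u >> = tprod letter2T (D << [:: x] >>) (D << u >>).
Proof. by rewrite -cat1s (gmorph_cat DM) scale1r. Qed.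

Hypothesis Da : D << [:: La] >> = << [:: (La, La)] >>.
Hypothesis Dc : D << [:: Lc] >> = << [:: (Lc, Lc)] >>.
Hypothesis Db :
  partial2 (D << [:: Lb] >>) = << [:: (Lc, Lc)] >> - << [:: (La, La)] >>.

Lemma gmorph_partial x : D (partial x) = partial2 (D x).
Proof.
elim/(@malg_ind R): x => [|k x y IHx IHy|u].
- by rewrite !linear0.
- by rewrite !linearP /= IHx IHy.
elim: u => [|x u IHu].
  rewrite (gmorph_unit DM) partialU linear0 partial2U !partialU /=.
  by rewrite box0l box0r scaler0 addr0.
have Dx : D (partial_letter x) = partial2 (D << [:: x] >>).
  case: x => /=; last 1 first.
  - by rewrite linear0 Dc partial2_letter /= box0l box0r scaler0 addr0.
  - by rewrite linear0 Da partial2_letter /= box0l box0r scaler0 addr0.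
  by rewrite Db linearB Da Dc.
rewrite (gmorph_cons x u) (partial2_tprod _ (gmorph_homog DM [:: x])) -IHu -Dx.
rewrite partial_cons [LHS]linearD [D (_ *: _)]linearZ_LR.
by congr (_ + _ *: _); apply: gmorphM.
Qed.

(** The index i.+1 is unrestricted: positions beyond the end of a word insert at
    the end in Omega and in Omega2 alike. *)
Lemma gmorph_face i x : D (face i.+1 x) = face2 i.+1 (D x).
Proof.
elim/(@malg_ind R): x => [|k x y IHx IHy|u].
- by rewrite !linear0.
- by rewrite !linearP /= IHx IHy.
elim: i u => [|i IHi] u.
  by rewrite face2_1 faceU /insert_a /= take0 drop0 gmorph_cons Da.
case: u => [|x u]; first by rewrite faceU (gmorph_unit DM) face2U; exact: Da.
rewrite (gmorph_cons x u) (face2_tprod _ _ (gmorph_homog DM [:: x])).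
rewrite -IHi !faceU.
exact: (gmorph_cons x (insert_a i.+1 u)).
Qed.

Lemma gmorph_is_Delta (w : Obar2 R) :
  (forall n, w n.+1 = D (L n.+1)) -> is_Delta w D.
Proof.
move=> wD; split.
- move=> k l x hx; apply: (supported_linear hx) => u [<- <-].
  exact/(homog_bidegree2 (size u) (ldeg u))/(gmorph_homog DM).
- by move=> x y; rewrite circE circ2E !(gmorphM _ _ DM) Dc.
- exact: gmorph_partial.
- by move=> k [|i] x _ // _; apply: gmorph_face.
- by case=> // n _; rewrite wD.
Qed.

End FromLetters.
End Comultiplication.

(** * The Maurer-Cartan equation *)

Section MaurerCartan.
Context {R : realType}.
Local Notation Om := (Omega R).
Local Notation Om2 := (Omega2 R).
Implicit Types (D : {linear Om -> Om2}) (w : Obar2 R).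

Lemma circ_L i j :
  circ (L i.+1) (L j.+1) = << nseq i Lb ++ Lc :: nseq j Lb >> :> Om.
Proof. by rewrite circE !tprodU !scale1r tprodU scale1r -catA. Qed.

Lemma face_L i j :
  face i.+1 (L (i + j).+1) = << nseq i Lb ++ La :: nseq j Lb >> :> Om.
Proof.
rewrite faceU /insert_a /= nseqD take_size_cat ?size_nseq //.
by rewrite drop_size_cat ?size_nseq.
Qed.

(** Reading c and a at position i.+1 as the product of two L's, resp. as a
    face of an L ([circ_L], [face_L]), this is the Maurer-Cartan equation of
    the universal sequence of the L n. *)
Lemma partial_L n : partial (L n.+1) =
  \sum_(i < n) (-1) ^+ i *:
    (<< nseq i Lb ++ Lc :: nseq (n - i.+1) Lb >>
     - << nseq i Lb ++ La :: nseq (n - i.+1) Lb >>) :> Om.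
Proof.
rewrite /L /=; elim: n => [|n IHn]; first by rewrite partialU big_ord0.
rewrite [nseq _ _]/= partial_cons IHn big_ord_recl /= expr0 scale1r subn1 /=.
rewrite tprodDl; congr (_ + _).
  by rewrite -scaleN1r tprodZl scaleN1r -!cons_tprod.
rewrite linear_sumr scaler_sumr; apply: eq_bigr => i _.
rewrite /= tprodZr scalerA -exprS tprodDr -scaleN1r tprodZr scaleN1r.
by rewrite -!cons_tprod /bump leq0n add1n subSS.
Qed.

(** In total degree 1 the sign of the star product depends on the left arity
    only. *)
Lemma star_term i (x y : Om2) :
    supported (fun u => kdeg u = i) x -> supported (fun v => tdeg v = 1) y ->
  bext (fun u v => (-1) ^ ((kdeg u)%:Z * tdeg v) *: circ2 << u >> << v >>) x y
  = (-1) ^+ i *: circ2 x y.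
Proof.
move=> hx hy; elim/(@supported_ind R): x / hx => [|k x x' IHx IHx'|u <-].
- by rewrite !linear0l scaler0.
- by rewrite !linearPl /= IHx IHx' scalerDr !scalerA mulrC.
elim/(@supported_ind R): y / hy => [|k y y' IHy IHy'|v hv].
- by rewrite !linear0r scaler0.
- by rewrite !linearPr /= IHy IHy' scalerDr !scalerA mulrC.
by rewrite bextU hv mulr1 signz signr_odd.
Qed.

Lemma mc_cancel (V : lmodType R) i (x y : V) :
  (-1) ^+ i *: (x - y) + (-1) ^ 1 *: ((-1) ^+ i.+1 *: y)
  + (-1) ^+ i.+1 *: x = 0.
Proof.
by rewrite expr1z exprS mulN1r !scaleNr scale1r opprK scalerBr subrK subrr.
Qed.

(** The structure map transports the identity [partial_L] to Omega2, where it
    reads as the Maurer-Cartan equation. *)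
Lemma is_Delta_MC D w : is_Delta w D -> w 0%N = 0 -> w 1%N = unit2 -> MC2 w.
Proof.
move=> wD w0 w1.
have wL n : w n.+1 = D (L n.+1) by rewrite (Delta_L wD).
have wdeg : Obar_deg 1 w.
  case=> [|n]; first by rewrite w0; apply: supported0.
  rewrite wL; apply: (Delta_deg wD); apply: supportedU.
  rewrite /kdeg /ldeg size_nseq count_nseq /= mul1n; split=> //; lia.
split=> // k.
have term i j :
    bext (fun u v => (-1) ^ ((kdeg u)%:Z * tdeg v) *: circ2 << u >> << v >>)
      (w i) (w j) = (-1) ^+ i *: circ2 (w i) (w j).
  apply: star_term; first by move=> u /wdeg[].
  by move=> u /wdeg[hk hl]; rewrite /tdeg hk hl; lia.
rewrite /dtot /star; under [X in _ + X]eq_bigr do rewrite term.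
case: k => [|n].
  by rewrite big_geq // big_ord_recl big_ord0 w0 !linear0 ?scaler0 ?addr0.
rewrite big_ord_recl big_ord_recr /= subnn w0 linear0l linear0r.
rewrite !scaler0 add0r addr0.
rewrite big_add1 /= big_mkord wL -(Delta_partial wD) partial_L linear_sum.
rewrite scaler_sumr -!big_split big1 // => i _ /=.
(* Writing n = i + j + 1 turns all truncated subtractions into j. *)
have [j Ej] : exists j, n = (i + j).+1.
  by exists (n - i.+1)%N; have := ltn_ord i; lia.
have -> : (n - i.+1)%N = j by lia.
rewrite /bump leq0n add1n subSS.
have -> : (n - i)%N = j.+1 by lia.
have -> : w n = D (L (i + j).+1) by rewrite -wL -Ej.
have aL : of_arity (i + j).+1 (L (i + j).+1 : Om).
  by apply: supportedU; rewrite /kdeg size_nseq.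
have le_i : (1 <= i.+1 <= (i + j).+1)%N by rewrite /= ltnS leq_addr.
rewrite !wL -(Delta_circ wD) circ_L -(Delta_face wD aL le_i) face_L.
rewrite [D (_ *: _)]linearZ_LR [D (_ - _)]linearB.
exact: mc_cancel.
Qed.

End MaurerCartan.

(** * Elements of arity 2 and degree -1 *)

Section Family.
Context {R : realType}.
Local Notation Om := (Omega R).
Local Notation Om2 := (Omega2 R).
Implicit Types (t : R) (D : {linear Om -> Om2}) (w : Obar2 R).

Definition basis2 x y : Om2 := << [:: (x, y)] >>.

Lemma box_letters x y : box << [:: x] >> << [:: y] >> = basis2 x y.
Proof. exact: boxU. Qed.

Lemma coef_basis2 x y k : (basis2 x y)@_k = ([:: (x, y)] == k)%:R.
Proof. exact: mcoeffU. Qed.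

Lemma omega_2E t : elB + t *: elA =
  (1 - t) *: basis2 Lb La + (1 - t) *: basis2 Lc Lb
  + t *: basis2 Lb Lc + t *: basis2 La Lb.
Proof.
have [eB eA] : elB = basis2 Lb La + basis2 Lc Lb
    /\ elA = basis2 Lb Lc + basis2 La Lb - basis2 Lb La - basis2 Lc Lb.
  by split; rewrite -!box_letters.
rewrite eB eA.
move: (basis2 Lb La) (basis2 Lc Lb) (basis2 Lb Lc) (basis2 La Lb) => x y z u.
rewrite !scalerBl !scale1r !scalerDr !scalerN.
rewrite [in RHS]addrACA -[RHS]addrA -[RHS]addrA [X in _ = _ + X]addrC.
by rewrite -[X in _ + X = _]addrA.
Qed.

Lemma homog_omega_2 t : homog letter2T 1 (-1) (elB + t *: elA).
Proof.
have hB x y : ldeg2 [:: (x, y)] = -1 -> homog letter2T 1 (-1) (basis2 x y).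
  by move=> h; apply: supportedU.
rewrite omega_2E; apply: supportedD; last by apply: supportedZ; apply: hB.
apply: supportedD; last by apply: supportedZ; apply: hB.
by apply: supportedD; apply: supportedZ; apply: hB.
Qed.

Lemma linear_comb4 (U V : lmodType R) (f : {linear U -> V}) (p q r s : R)
    x y z u x' y' z' u' :
  f x = x' -> f y = y' -> f z = z' -> f u = u' ->
  f (p *: x + q *: y + r *: z + s *: u) = p *: x' + q *: y' + r *: z' + s *: u'.
Proof. by move=> <- <- <- <-; rewrite !linearD !linearZ_LR. Qed.

Lemma partial2_comb (p q r s : R) :
  partial2 (p *: basis2 Lb La + s *: basis2 Lc Lb
            + q *: basis2 Lb Lc + r *: basis2 La Lb) =
  p *: (basis2 Lc La - basis2 La La) + s *: (basis2 Lc Lc - basis2 Lc La)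
  + q *: (basis2 Lc Lc - basis2 La Lc) + r *: (basis2 La Lc - basis2 La La).
Proof.
have pba : partial2 (basis2 Lb La) = basis2 Lc La - basis2 La La.
  rewrite partial2_letter /= box0r scaler0 addr0 -!box_letters; exact: linearBl.
have pbc : partial2 (basis2 Lb Lc) = basis2 Lc Lc - basis2 La Lc.
  rewrite partial2_letter /= box0r scaler0 addr0 -!box_letters; exact: linearBl.
have pab : partial2 (basis2 La Lb) = basis2 La Lc - basis2 La La.
  rewrite partial2_letter /= box0l add0r scale1r -!box_letters; exact: linearBr.
have pcb : partial2 (basis2 Lc Lb) = basis2 Lc Lc - basis2 Lc La.
  rewrite partial2_letter /= box0l add0r scale1r -!box_letters; exact: linearBr.
apply: linear_comb4; [exact: pba|exact: pcb|exact: pbc|exact: pab].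
Qed.

Lemma homog_coef z : homog letter2T 1 (-1) z ->
  z = z@_[:: (Lb, La)] *: basis2 Lb La + z@_[:: (Lc, Lb)] *: basis2 Lc Lb
      + z@_[:: (Lb, Lc)] *: basis2 Lb Lc + z@_[:: (La, Lb)] *: basis2 La Lb.
Proof.
move=> hz; apply/malgP => k.
have z0 : ~ (size k = 1%N /\ deg letter2T k = -1) -> z@_k = 0.
  by move=> hk; apply: mcoeff_outdom; apply/negP => /hz.
move: basis2 coef_basis2 => e eE.
rewrite !mcoeffD !mcoeffZ !eE.
case: k z0 => [|[x y] [|q k]] z0.
- by rewrite z0 ?mulr0 ?addr0 // => -[].
- case: x z0 => z0; case: y z0 => z0;
    by rewrite /= !(mulr1, mulr0, addr0, add0r) //; apply: z0 => -[_ /eqP].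
by rewrite z0 ?eqseq_cons ?andbF ?mulr0 ?addr0 // => -[].
Qed.

(** With p, s, q, r the coefficients of b (x) a, c (x) b, b (x) c, a (x) b in z,
    the coefficients of c (x) a, a (x) c and c (x) c in its differential give
    p = s, q = r and q + s = 1, so that q is the parameter. *)
Lemma homog_partial2_eq z : homog letter2T 1 (-1) z ->
  partial2 z = basis2 Lc Lc - basis2 La La -> exists t, z = elB + t *: elA.
Proof.
move=> hz; have := homog_coef hz.
move: (z@_[:: (Lb, La)]) (z@_[:: (Lc, Lb)]) => p s.
move: (z@_[:: (Lb, Lc)]) (z@_[:: (La, Lb)]) => q r ->.
rewrite partial2_comb => E; exists q; rewrite omega_2E.
suff [-> -> ->] : [/\ p = 1 - q, s = 1 - q & r = q] by [].
(* From here on only the coefficients of the basis elements matter, so the basis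
   is replaced by an arbitrary family with these coefficients. *)
move: basis2 coef_basis2 E => e eE E.
have E1 := congr1 (mcoeff [:: (Lc, La)]) E.
have E2 := congr1 (mcoeff [:: (La, Lc)]) E.
have E3 := congr1 (mcoeff [:: (Lc, Lc)]) E.
rewrite !(mcoeffD, mcoeffZ, mcoeffN) !eE /= in E1 E2 E3.
split; lra.
Qed.
End Family.

(** * Rigid elements *)

Section Rigid.
Context {R : realType}.
Local Notation Om := (Omega R).
Local Notation Om2 := (Omega2 R).
Implicit Types (t : R) (D : {linear Om -> Om2}) (w : Obar2 R).

Definition coprod_letter t (x : letter) : Om2 :=
  if x is Lb then elB + t *: elA else basis2 x x.

Definition Delta t : Om -> Om2 := lext (wext letter2T (coprod_letter t)).

HB.instance Definition _ t := GRing.Linear.copy (Delta t) (lext _).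

Lemma gmorph_Delta t : gmorph letterT letter2T (Delta t).
Proof.
apply: gmorph_wext => // -[] /=; try by apply: supportedU.
exact: homog_omega_2.
Qed.

Lemma Delta_letter t x : Delta t << [:: x] >> = coprod_letter t x.
Proof. by rewrite /Delta lextU /= tprod1r. Qed.

Lemma pow2E (x : Om2) n : pow2 x n = iter n (tprod letter2T x) << [:: ] >>.
Proof.
elim: n => [|n IHn]; first exact: boxU.
by rewrite -[LHS]/(dia2 x (pow2 x n)) dia2E IHn.
Qed.

Lemma Delta_omega t n : omega_ t n.+1 = Delta t (L n.+1).
Proof.
rewrite /= pow2E /Delta /L lextU /=.
by elim: n => //= n ->.
Qed.

Lemma is_Delta_omega t : is_Delta (omega_ t) (Delta t).
Proof.
apply: (gmorph_is_Delta (gmorph_Delta t)).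
- exact: Delta_letter.
- exact: Delta_letter.
- apply: (etrans (congr1 _ (Delta_letter t Lb))).
  rewrite /coprod_letter omega_2E partial2_comb.
  rewrite -/(basis2 Lc Lc) -/(basis2 La La).
  move: (basis2 Lc La) (basis2 La La) (basis2 Lc Lc) (basis2 La Lc) => x y z u.
  rewrite -scalerDr [x - y + _]addrC subrKA -addrA -scalerDr subrKA.
  by rewrite -scalerDl subrK scale1r.
exact: Delta_omega.
Qed.

Lemma MC2_omega t : MC2 (omega_ t).
Proof. exact: is_Delta_MC (is_Delta_omega t) _ _. Qed.

Lemma rigid_omega t : rigid (omega_ t).
Proof.
exists (Delta t); split; first exact: is_Delta_omega.
  exact: etrans (gmorph_unit (gmorph_Delta t)) (esym unit2E).
by move=> x y; rewrite diaE dia2E; apply: gmorphM; apply: gmorph_Delta.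
Qed.

(** Rigidity fixes D on the three letters up to one parameter, hence fixes D and
    omega. *)
Lemma rigid_is_omega w : MC2 w -> rigid w -> exists t, w = omega_ t.
Proof.
case=> wdeg _ w1 [D [wD D1 DM]].
have Da : D a_ = basis2 La La.
  have -> : a_ = face 1 unitO :> Om by rewrite faceU.
  rewrite (@Delta_face _ _ _ wD 1) // ?D1 ?unit2E ?face2U //.
  by apply: supportedU.
have Dc : D c_ = basis2 Lc Lc.
  have -> : c_ = circ unitO unitO :> Om by rewrite circE tprod1l tprod1r.
  rewrite (Delta_circ wD) D1 unit2E circ2E tprod1r; exact: tprod1l.
have hb : homog letter2T 1 (-1) (D b_).
  by apply/(homog_bidegree2 1)/(Delta_deg wD); apply: supportedU.
have [t Db] : exists t, D b_ = elB + t *: elA.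
  apply: homog_partial2_eq hb _.
  by rewrite -(Delta_partial wD) partial_letterE /= linearB Da Dc.
exists t; apply: funext => -[|n].
  apply/malgP => u; rewrite mcoeff0 mcoeff_outdom //.
  by apply/negP => /wdeg[].
rewrite -(Delta_L wD) //= -Db; elim: n => [|n IHn]; first exact: D1.
have -> : L n.+2 = dia b_ (L n.+1) :> Om by rewrite diaE -cons_tprod.
by rewrite DM IHn.
Qed.

End Rigid.

(** * Symmetric elements *)

Section Symmetric.
Context {R : realType}.
Local Notation Om := (Omega R).
Local Notation Om2 := (Omega2 R).
Implicit Types (t : R).

Lemma flipU w : flip << w >> =
  (-1) ^+ (par letterT (unzip1 w) && par letterT (unzip2 w)) *:
  << [seq (p.2, p.1) | p <- w] >> :> Om2.
Proof.
rewrite /flip lextU signzM boxU ?size_map //; congr (_ *: << _ >>).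
by elim: w => //= p w ->.
Qed.

(** Multiplicative because |u1| |u2| is a quadratic function on degrees whose
    polarization accounts for the difference of the two Koszul signs. *)
Lemma gmorph_flip : gmorph letter2T letter2T (@flip R).
Proof.
have e1 (w : seq (letter * letter)) :
    unzip1 [seq (p.2, p.1) | p <- w] = unzip2 w.
  by rewrite /unzip1 /unzip2 -map_comp; apply: eq_map.
have e2 (w : seq (letter * letter)) :
    unzip2 [seq (p.2, p.1) | p <- w] = unzip1 w.
  by rewrite /unzip1 /unzip2 -map_comp; apply: eq_map.
split=> [|u v|u]; rewrite !flipU.
- by rewrite scale1r.
- rewrite tprodZl tprodZr tprodU map_cat !scalerA -!signr_addb.
  rewrite /= /boxtw_tw !e1 !e2 /unzip1 /unzip2 !map_cat !parD /=.
  by congr (_ *: _); do 4!case: (par _ _).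
apply: supportedZ; apply: supportedU; rewrite size_map /= /boxtw_deg e1 e2.
by rewrite addrC.
Qed.

Lemma flip_basis2 x y : flip (basis2 x y) =
  (-1) ^+ (par letterT [:: x] && par letterT [:: y]) *: basis2 y x :> Om2.
Proof. exact: flipU. Qed.

(** The right-hand side is B + (1 - t) A: the flip acts on the parameter by
    t |-> 1 - t. *)
Lemma flip_omega_2 t : flip (elB + t *: elA) =
  (1 - t) *: basis2 La Lb + (1 - t) *: basis2 Lb Lc
  + t *: basis2 Lc Lb + t *: basis2 Lb La :> Om2.
Proof.
have fE x y : par letterT [:: x] && par letterT [:: y] = false ->
    flip (basis2 x y) = basis2 y x :> Om2.
  by move=> h; rewrite flip_basis2 h scale1r.
by rewrite omega_2E; apply: linear_comb4; apply: fE.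
Qed.

Lemma addr_rev4 (V : zmodType) (x y z u : V) : x + y + z + u = u + z + y + x.
Proof. by rewrite (addrC _ u) (addrC _ z) (addrC x y) !addrA. Qed.

Lemma symmetric_omega t : symmetric_MC (omega_ t) <-> t = 1 / 2%:R.
Proof.
split=> [/(_ 2) |->].
  (* The component of arity 2 is B + t A itself. *)
  rewrite /= /pow2 /= dia2E unit2E tprod1r flip_omega_2 omega_2E.
  move: (@basis2 R) (@coef_basis2 R) => e eE /(congr1 (mcoeff [:: (Lb, La)])).
  rewrite !(mcoeffD, mcoeffZ) !eE /= => E; lra.
case=> [|n]; first exact: linear0.
have fx : flip (elB + (1 / 2%:R) *: elA) = elB + (1 / 2%:R) *: elA :> Om2.
  rewrite flip_omega_2 omega_2E (_ : 1 - 1 / 2%:R = 1 / 2%:R :> R); last by lra.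
  exact: addr_rev4.
rewrite /omega_ pow2E; elim: n => [|n IHn].
  exact: (gmorph_unit gmorph_flip).
exact: etrans (gmorphM _ _ gmorph_flip) (congr2 (tprod letter2T) fx IHn).
Qed.

End Symmetric.

(** * Associative elements *)

Section Associative.
Context {R : realType}.
Local Notation Om := (Omega R).
Local Notation Om2 := (Omega2 R).
Implicit Types (t : R).

Definition basis3 x y z : {malg R[seq ((letter * letter) * letter)]} :=
  << [:: ((x, y), z)] >>.

Lemma coef_basis3 x y z k : (basis3 x y z)@_k = ([:: ((x, y), z)] == k)%:R.
Proof. exact: mcoeffU. Qed.

Definition left_coprod t : Om -> {malg R[seq ((letter * letter) * letter)]} :=
  boxmap (Delta t) id \o Delta t.
Definition right_coprod t : Om -> {malg R[seq ((letter * letter) * letter)]} :=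
  (@box_assoc R letter letter letter) \o (boxmap id (Delta t) \o Delta t).

HB.instance Definition _ t := GRing.Linear.copy (left_coprod t)
  (boxmap (Delta t) id \o Delta t).
HB.instance Definition _ t := GRing.Linear.copy (right_coprod t)
  ((@box_assoc R letter letter letter) \o (boxmap id (Delta t) \o Delta t)).

Lemma gmorph_left t : gmorph letterT (boxtw letter2T letterT) (left_coprod t).
Proof.
have h := gmorph_boxmap (gmorph_Delta t) (@gmorph_id R _ letterT).
exact: gmorph_comp (gmorph_Delta t) h.
Qed.

Lemma gmorph_right t : gmorph letterT (boxtw letter2T letterT) (right_coprod t).
Proof.
have h := gmorph_boxmap (@gmorph_id R _ letterT) (gmorph_Delta t).
have h' := gmorph_comp (gmorph_Delta t) h.
exact: gmorph_comp h' (gmorph_box_assoc letterT letterT letterT).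
Qed.

Lemma left_coprod_basis2 t x y :
  boxmap (Delta t) id (basis2 x y) = box (coprod_letter t x) << [:: y] >>.
Proof. by rewrite /basis2 boxmapU /= Delta_letter. Qed.

Lemma right_coprod_basis2 t x y :
  boxmap id (Delta t) (basis2 x y) = box << [:: x] >> (coprod_letter t y).
Proof. by rewrite /basis2 boxmapU /= Delta_letter. Qed.

Lemma box_basis2l x y z : box (basis2 x y) << [:: z] >> = basis3 x y z.
Proof. exact: boxU. Qed.

Lemma box_assoc_basis x y z :
  box_assoc (box << [:: x] >> (basis2 y z)) = basis3 x y z.
Proof. by rewrite boxU //= /box_assoc lextU. Qed.

Lemma box_omega_2l t z : box (elB + t *: elA) << [:: z] >> =
  (1 - t) *: basis3 Lb La z + (1 - t) *: basis3 Lc Lb z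
  + t *: basis3 Lb Lc z + t *: basis3 La Lb z.
Proof.
rewrite omega_2E; apply: (linear_comb4 (f := applyr (@box R _ _) _));
exact: box_basis2l.
Qed.

Lemma box_omega_2r t x :
  box_assoc (box << [:: x] >> (elB + t *: elA)) =
  (1 - t) *: basis3 x Lb La + (1 - t) *: basis3 x Lc Lb
  + t *: basis3 x Lb Lc + t *: basis3 x La Lb.
Proof.
rewrite omega_2E.
apply: (linear_comb4 (f := @box_assoc R _ _ _ \o box << [:: x] >>));
exact: box_assoc_basis.
Qed.

Lemma left_coprod_b t : left_coprod t << [:: Lb] >> =
  (1 - t) *: ((1 - t) *: basis3 Lb La La + (1 - t) *: basis3 Lc Lb La
              + t *: basis3 Lb Lc La + t *: basis3 La Lb La)
  + (1 - t) *: basis3 Lc Lc Lb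
  + t *: ((1 - t) *: basis3 Lb La Lc + (1 - t) *: basis3 Lc Lb Lc
          + t *: basis3 Lb Lc Lc + t *: basis3 La Lb Lc)
  + t *: basis3 La La Lb.
Proof.
rewrite /left_coprod /= Delta_letter /= omega_2E.
apply: (linear_comb4 (f := boxmap (Delta t) id)).
- exact: etrans (left_coprod_basis2 t Lb La) (box_omega_2l t La).
- exact: etrans (left_coprod_basis2 t Lc Lb) (box_basis2l Lc Lc Lb).
- exact: etrans (left_coprod_basis2 t Lb Lc) (box_omega_2l t Lc).
- exact: etrans (left_coprod_basis2 t La Lb) (box_basis2l La La Lb).
Qed.

Lemma right_coprod_b t : right_coprod t << [:: Lb] >> =
  (1 - t) *: basis3 Lb La La
  + (1 - t) *: ((1 - t) *: basis3 Lc Lb La + (1 - t) *: basis3 Lc Lc Lb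
                + t *: basis3 Lc Lb Lc + t *: basis3 Lc La Lb)
  + t *: basis3 Lb Lc Lc
  + t *: ((1 - t) *: basis3 La Lb La + (1 - t) *: basis3 La Lc Lb
          + t *: basis3 La Lb Lc + t *: basis3 La La Lb).
Proof.
rewrite /right_coprod /= Delta_letter /= omega_2E.
apply: (linear_comb4 (f := @box_assoc R _ _ _ \o boxmap id (Delta t))).
- exact: etrans (congr1 _ (right_coprod_basis2 t Lb La))
    (box_assoc_basis Lb La La).
- exact: etrans (congr1 _ (right_coprod_basis2 t Lc Lb)) (box_omega_2r t Lc).
- exact: etrans (congr1 _ (right_coprod_basis2 t Lb Lc))
    (box_assoc_basis Lb Lc Lc).
- exact: etrans (congr1 _ (right_coprod_basis2 t La Lb)) (box_omega_2r t La).
Qed.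

(** The letters other than b are grouplike for [Delta t]. *)
Lemma coassoc_grouplike t x : x != Lb ->
  left_coprod t << [:: x] >> = right_coprod t << [:: x] >>.
Proof.
move=> xb; have Dx : coprod_letter t x = basis2 x x by case: x xb.
rewrite /left_coprod /right_coprod /= Delta_letter Dx left_coprod_basis2.
rewrite right_coprod_basis2 Dx box_basis2l; exact/esym/box_assoc_basis.
Qed.

(** With f the coefficient of (b (x) c) (x) a and e the basis of triple tensors,
    the hypothesis is coassociativity at b.  On the left only x_t (x) a, of
    weight 1 - t, contributes; on the right b (x) c is followed by c only. *)
Lemma coassoc_coef (V : lmodType R) (f : V -> R)
    (e : letter -> letter -> letter -> V) t :
    {morph f : x y / x + y} -> (forall k x, f (k *: x) = k * f x) ->
    (forall x y z, f (e x y z) = ((x, y, z) == (Lb, Lc, La))%:R) ->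
  (1 - t) *: ((1 - t) *: e Lb La La + (1 - t) *: e Lc Lb La
              + t *: e Lb Lc La + t *: e La Lb La)
  + (1 - t) *: e Lc Lc Lb
  + t *: ((1 - t) *: e Lb La Lc + (1 - t) *: e Lc Lb Lc
          + t *: e Lb Lc Lc + t *: e La Lb Lc)
  + t *: e La La Lb =
  (1 - t) *: e Lb La La
  + (1 - t) *: ((1 - t) *: e Lc Lb La + (1 - t) *: e Lc Lc Lb
                + t *: e Lc Lb Lc + t *: e Lc La Lb)
  + t *: e Lb Lc Lc
  + t *: ((1 - t) *: e La Lb La + (1 - t) *: e La Lc Lb
          + t *: e La Lb Lc + t *: e La La Lb) ->
  (1 - t) * t = 0.
Proof.
move=> fD fZ fe /(congr1 f); rewrite !(fD, fZ) !fe /=.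
by rewrite !(mulr0, mulr1, addr0, add0r).
Qed.

Lemma associative_omega t : associative_MC (omega_ t) <-> t = 0 \/ t = 1.
Proof.
split=> [[D [wD DA]]|t01].
  have E : left_coprod t << [:: Lb] >> = right_coprod t << [:: Lb] >>.
    have DE : D = Delta t :> (Om -> Om2).
      exact/funext/(is_Delta_unique wD (is_Delta_omega t)).
    by move: (DA << [:: Lb] >>); rewrite DE.
  have /eqP : (1 - t) * t = 0.
    move: E; rewrite left_coprod_b right_coprod_b.
    apply: (coassoc_coef (f := mcoeff [:: ((Lb, Lc), La)])) => [x y|k x|x y z].
    - exact: mcoeffD.
    - exact: mcoeffZ.
    - by rewrite coef_basis3; case: x; case: y; case: z.
  by rewrite mulf_eq0 subr_eq0 => /orP[/eqP<-|/eqP->]; [right|left].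
exists (Delta t); split; first exact: is_Delta_omega.
apply: (eq_gmorph (gmorph_left t) (gmorph_right t)) => -[].
- exact: coassoc_grouplike.
- apply: (etrans (left_coprod_b t)); apply/esym/(etrans (right_coprod_b t)).
  move: basis3 => e; case: t01 => ->; rewrite ?subr0 ?subrr.
    by rewrite !(scale0r, scale1r, scaler0, addr0, add0r) addrA.
  by rewrite !(scale0r, scale1r, scaler0, addr0, add0r) addrA.
exact: coassoc_grouplike.
Qed.

End Associative.

Theorem corollary5p10 (R : realType) :
  [/\ [set w : Obar2 R | MC2 w /\ rigid w] = range (@omega_ R),
      forall t : R, symmetric_MC (omega_ t) <-> t = 1 / 2%:R
    & forall t : R, associative_MC (omega_ t) <-> t = 0 \/ t = 1].
Proof.
split; [|exact: symmetric_omega|exact: associative_omega].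
apply/seteqP; split=> [w [wMC wr]|_ [t _ <-]].
  by have [t ->] := rigid_is_omega wMC wr; exists t.
by split; [apply: MC2_omega|apply: rigid_omega].
Qed.
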